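(* Let $\Pi=\{\pi_1,\dots,\pi_m\}\in\wp$, let $x_0\in\mathbb{R}^n$, and let $\{x_k\}_{k\ge 0}$ be the iterates of the GBCD method with initial guess $x_0$ and input partition $\Pi$, applied to $\min_{x\in\mathbb{R}^n} f(x)$. Then $x_k\to x_{\text{opt}}$ as $k\to\infty$, with convergence rate $\mathcal{C}(\Pi)$ bounded above by $$1-\frac{1}{m}\,\lambda_{\min}\big(P_{\Pi}B_{\Pi}^{-1}\big).$$
   Context: Let $P\in\mathbb{R}^{n\times n}$ be symmetric positive definite, $q\in\mathbb{R}^n$, $r\in\mathbb{R}$, and $f(x)=\frac12 x^tPx-x^tq+r$, so $\nabla f(x)=Px-q$ and the unique minimizer is $x_{\text{opt}}=P^{-1}q$. Write $\|x\|_P=\sqrt{x^tPx}$. For $\pi\subseteq[n]=\{1,\dots,n\}$: $P_\pi$ is the submatrix of $P$ formed by the rows with indices in $\pi$; $\mathbb{I}_\pi$ is the submatrix of the $n\times n$ identity matrix formed by the rows with indices in $\pi$; $q_\pi$ is the subvector of $q$ with indices in $\pi$; and $P_{\pi\pi}=P_\pi\mathbb{I}_\pi^t$. $\wp$ is the set of partitions $\Pi=\{\pi_1,\dots,\pi_m\}$ of $[n]$ (into nonempty sets) with $d:=\max_i|\pi_i|<\min\{\sqrt n,\rho(n)\}$, where $\rho(n)$ is a fixed positive integer (the number of rows of $P$ that fit in main memory). For $\pi_i\in\Pi$ let $\nabla_{\pi_i}f(x)=P_{\pi_i}x-q_{\pi_i}$ and $\beta_{\pi_i}(x)=\nabla_{\pi_i}f(x)^t\,P_{\pi_i\pi_i}^{-1}\,\nabla_{\pi_i}f(x)$.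 GBCD (greedy block coordinate descent) method with input $x_0$ and $\Pi$: for $k=0,1,2,\dots$, choose $\pi\in\operatorname{argmax}_{\pi_i\in\Pi}\beta_{\pi_i}(x_k)$ (ties broken arbitrarily) and set $x_{k+1}=x_k+\mathbb{I}_\pi^t(P_{\pi\pi})^{-1}(q_\pi-P_\pi x_k)$. The convergence rate is $\mathcal{C}(\Pi)=\sup_{k}\mathcal{C}_k(\Pi)$, where $\mathcal{C}_k(\Pi)=\|x_{k+1}-x_{\text{opt}}\|_P^2/\|x_k-x_{\text{opt}}\|_P^2$ and the supremum is over all $k\ge0$ with $x_k\ne x_{\text{opt}}$ (taken to be $0$ if there is no such $k$). Let $\mathbb{I}_\Pi=[\mathbb{I}_{\pi_1}^t\cdots\mathbb{I}_{\pi_m}^t]^t$ (a row permutation of the identity), $P_\Pi=\mathbb{I}_\Pi P\,\mathbb{I}_\Pi^t$, and let $B_\Pi$ be the block diagonal matrix with diagonal blocks $P_{\pi_1\pi_1},\dots,P_{\pi_m\pi_m}$. $\lambda_{\min}(P_\Pi B_\Pi^{-1})$ denotes the smallest eigenvalue of $P_\Pi B_\Pi^{-1}$ (its eigenvalues are all real). *)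

(* Defs.v *)
From HB Require Import structures.
From mathcomp Require Import all_boot all_order all_algebra.
From mathcomp Require Import ring lra.
From mathcomp Require Import all_classical all_reals all_analysis.

Set Implicit Arguments.
Unset Strict Implicit.
Unset Printing Implicit Defensive.

Import Order.TTheory GRing.Theory Num.Theory.
Import numFieldNormedType.Exports.

Local Open Scope classical_set_scope.
Local Open Scope ring_scope.

Definition spd (R : realType) (n : nat) (P : 'M[R]_n) : Prop :=
  P^T = P /\ forall x : 'cV[R]_n, x != 0 -> 0 < (x^T *m P *m x) 0 0.

Definition quadf (R : realType) (n : nat) (P : 'M[R]_n) (q : 'cV[R]_n) (r : R)
    (x : 'cV[R]_n) : R :=
  2^-1 * (x^T *m P *m x) 0 0 - (x^T *m q) 0 0 + r.

Definition is_minimizer (T : Type) (R : realType) (f : T -> R) (x : T) : Prop :=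
  forall y, f x <= f y.

Definition normP (R : realType) (n : nat) (P : 'M[R]_n) (x : 'cV[R]_n) : R :=
  Num.sqrt ((x^T *m P *m x) 0 0).

(* The elements of A are listed in increasing order by enum_val. *)
Definition rows_of (R : Type) (n p : nat) (A : {set 'I_n}) (M : 'M[R]_(n, p)) :
    'M[R]_(#|A|, p) :=
  rowsub (fun i : 'I_#|A| => enum_val i) M.

Definition idrows (R : realType) (n : nat) (A : {set 'I_n}) : 'M[R]_(#|A|, n) :=
  rows_of A 1%:M.

Definition blk (R : realType) (n : nat) (P : 'M[R]_n) (A : {set 'I_n}) :
    'M[R]_#|A| :=
  rows_of A P *m (idrows R A)^T.

(* pi lists, without repetition, the blocks of a partition of 'I_n (partition
   requires them to be nonempty); rho n is the number of rows of the matrix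
   that fit in main memory. *)
Definition admissible (R : realType) (rho : nat -> nat) (n m : nat)
    (pi : 'I_m -> {set 'I_n}) : Prop :=
  [/\ injective pi,
      finset.partition [set pi i | i : 'I_m]%SET [set: 'I_n]%SET
    & ((\max_(i < m) #|pi i|)%N%:R : R)
        < Num.min (Num.sqrt (n%:R : R)) ((rho n)%:R : R)].

Definition pgrad (R : realType) (n : nat) (P : 'M[R]_n) (q : 'cV[R]_n)
    (A : {set 'I_n}) (x : 'cV[R]_n) : 'cV[R]_#|A| :=
  rows_of A P *m x - rows_of A q.

Definition beta (R : realType) (n : nat) (P : 'M[R]_n) (q : 'cV[R]_n)
    (A : {set 'I_n}) (x : 'cV[R]_n) : R :=
  ((pgrad P q A x)^T *m invmx (blk P A) *m pgrad P q A x) 0 0.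

Definition bcd_step (R : realType) (n : nat) (P : 'M[R]_n) (q : 'cV[R]_n)
    (A : {set 'I_n}) (x : 'cV[R]_n) : 'cV[R]_n :=
  x + (idrows R A)^T *m invmx (blk P A) *m (rows_of A q - rows_of A P *m x).

(* A relation rather than a function, since ties are broken arbitrarily. *)
Definition gbcd (R : realType) (n m : nat) (P : 'M[R]_n) (q : 'cV[R]_n)
    (pi : 'I_m -> {set 'I_n}) (x0 : 'cV[R]_n) (x : nat -> 'cV[R]_n) : Prop :=
  x 0%N = x0 /\
  forall k, exists i : 'I_m,
    (forall j : 'I_m, beta P q (pi j) (x k) <= beta P q (pi i) (x k)) /\
    x k.+1 = bcd_step P q (pi i) (x k).

Definition rate_at (R : realType) (n : nat) (P : 'M[R]_n) (xopt : 'cV[R]_n)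
    (x : nat -> 'cV[R]_n) (k : nat) : R :=
  normP P (x k.+1 - xopt) ^+ 2 / normP P (x k - xopt) ^+ 2.

(* The supremum is taken in \bar R so that it is +oo, and not a default value,
   when the ratios are unbounded. *)
Definition rate (R : realType) (n : nat) (P : 'M[R]_n) (xopt : 'cV[R]_n)
    (x : nat -> 'cV[R]_n) : \bar R :=
  if `[< exists k, x k != xopt >] then
    ereal_sup [set (rate_at P xopt x k)%:E | k in [set k | x k != xopt]]
  else 0%E.

Definition idPi (R : realType) (n m : nat) (pi : 'I_m -> {set 'I_n}) :
    'M[R]_(\sum_(i < m) #|pi i|, n) :=
  \mxcol_(i < m) idrows R (pi i).

Definition permPi (R : realType) (n m : nat) (P : 'M[R]_n)
    (pi : 'I_m -> {set 'I_n}) : 'M[R]_(\sum_(i < m) #|pi i|) :=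
  idPi R pi *m P *m (idPi R pi)^T.

Definition blockPi (R : realType) (n m : nat) (P : 'M[R]_n)
    (pi : 'I_m -> {set 'I_n}) : 'M[R]_(\sum_(i < m) #|pi i|) :=
  \mxdiag_(i < m) blk P (pi i).

(* The smallest real eigenvalue, by lambda_minP, if there is one. *)
Definition lambda_min (R : realType) (N : nat) (M : 'M[R]_N) : R :=
  inf [set a : R | eigenvalue M a].

Lemma lambda_minP (R : realType) (N : nat) (M : 'M[R]_N) (a0 : R) :
  eigenvalue M a0 ->
  eigenvalue M (lambda_min M) /\
  forall a, eigenvalue M a -> lambda_min M <= a.
Proof.
move=> ea0; set E := [set a : R | eigenvalue M a].
have [s Es] : exists s : seq R, forall a, eigenvalue M a -> a \in s.
  apply: contrapT => /forallNP H.
  have K j : exists s : seq R, [/\ uniq s, size s = j & all (eigenvalue M) s].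
    elim: j => [|j [s [us ss als]]]; first by exists [::].
    have [a /not_implyP [ea /negP nas]] := (existsNP _).2 (H s).
    by exists (a :: s); rewrite /= nas us ss ea als.
  have [s [us ss als]] := K N.+1.
  have p0 : char_poly M != 0 by rewrite monic_neq0 // char_poly_monic.
  have als' : all (root (char_poly M)) s.
    by apply: sub_all als => a; rewrite eigenvalue_root_char.
  by have := max_poly_roots p0 als' us; rewrite size_char_poly ss ltnn.
pose t := [seq a <- s | eigenvalue M a].
have tE a : (a \in t) = eigenvalue M a.
  by rewrite mem_filter andb_idr //; exact: Es.
have [b bt bmin] : exists2 b, b \in t & forall a, a \in t -> b <= a.
  have : a0 \in t by rewrite tE.
  elim: t {tE} a0 {ea0} => [|c t IH] a //= _.
  case: t IH => [|d t] IH.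
    by exists c; rewrite ?mem_head // => y; rewrite inE => /eqP ->.
  have [b bt bm] := IH d (mem_head _ _).
  have [cb|/ltW bc] := leP c b.
    exists c; rewrite ?mem_head // => y; rewrite inE => /predU1P[-> //|yt].
    exact: le_trans cb (bm _ yt).
  exists b; first by rewrite inE bt orbT.
  by move=> y; rewrite inE => /predU1P[-> //|]; exact: bm.
have lbE : lbound E b by move=> a Ea; apply: bmin; rewrite tE.
have Eb : E b by rewrite /E /= -tE.
suff -> : lambda_min M = b by split=> // a Ea; exact: lbE.
apply/eqP; rewrite eq_le; apply/andP; split.
  by apply: ge_inf => //; exists b.
by apply: lb_le_inf => //; exists b.
Qed.

Lemma quadf_minimizerP (R : realType) (n : nat) (P : 'M[R]_n) (q : 'cV[R]_n)
    (r : R) (x : 'cV[R]_n) :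
  spd P -> is_minimizer (quadf P q r) x <-> x = invmx P *m q.
Proof.
move=> [sP pP].
have uP : P \in unitmx.
  rewrite unitmxE unitfE; apply/det0P => -[v v0 vP].
  have := pP v^T; rewrite trmxK vP mul0mx mxE ltxx => /(_ _)/negP; apply => //.
  by rewrite -trmx0 (inj_eq trmx_inj).
pose z := invmx P *m q.
have Pz : P *m z = q by rewrite mulmxA mulmxV // mul1mx.
have key y : quadf P q r y
    = quadf P q r z + 2^-1 * ((y - z)^T *m P *m (y - z)) 0 0.
  have zy : (z^T *m P *m y) 0 0 = (y^T *m q) 0 0.
    have -> : z^T *m P *m y = (y^T *m P *m z)^T.
      by rewrite !trmx_mul sP trmxK mulmxA.
    by rewrite mxE -mulmxA Pz.
  have yz : (y^T *m P *m z) 0 0 = (y^T *m q) 0 0 by rewrite -mulmxA Pz.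
  have zz : (z^T *m P *m z) 0 0 = (z^T *m q) 0 0 by rewrite -mulmxA Pz.
  have -> : ((y - z)^T *m P *m (y - z)) 0 0 =
    (y^T *m P *m y) 0 0 - (z^T *m P *m y) 0 0
     - ((y^T *m P *m z) 0 0 - (z^T *m P *m z) 0 0).
    rewrite [(y - z)^T]linearB /= mulmxBr !mulmxBl.
    have subE (A B : 'M[R]_1) : (A - B) 0 0 = A 0 0 - B 0 0 by rewrite !mxE.
    by rewrite !subE; ring.
  by rewrite /quadf zy yz zz; field.
split=> [minx|->].
  apply/eqP; rewrite -subr_eq0; apply/negPn/negP => /pP.
  by have := minx z; rewrite (key x) -/z; lra.
move=> y; rewrite (key y) lerDl mulr_ge0 ?invr_ge0 //.
have [->|/pP/ltW //] := eqVneq (y - z) 0.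
by rewrite mulmx0 mxE.
Qed.

(* Main.v *)
Require Import Defs.
From HB Require Import structures.
From mathcomp Require Import all_boot all_order all_algebra.
From mathcomp Require Import ring lra.
From mathcomp Require Import all_classical all_reals all_analysis.

Set Implicit Arguments.
Unset Strict Implicit.
Unset Printing Implicit Defensive.

Import Order.TTheory GRing.Theory Num.Theory.
Import numFieldNormedType.Exports.

Local Open Scope classical_set_scope.
Local Open Scope ring_scope.

(** A greedy step on the block A is an exact minimization of f over the
    coordinates in A, so it lowers the energy E(x) = (x - xopt)^T P (x - xopt)
    by exactly beta_A(x) ([bcd_step_decrease]).  The greedy choice makes this
    decrease the largest of the m values beta_i(x), hence at least their
    average.

    With e = x - xopt, the sum of the beta_i(x) is e^T P S P e, where
    S = I_Pi^T B_Pi^-1 I_Pi.  The minimum mu of the generalized Rayleigh quotient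
    (e^T P S P e) / (e^T P e) is attained at some v, and stationarity there reads
    P S P v = mu P v ([pencil_min]).  Pushing this eigenvector through I_Pi and
    B_Pi^-1 turns it into one of P_Pi B_Pi^-1 with the same eigenvalue mu
    ([block_gap]), so lambda_min <= mu and
<<
      E(x_(k+1)) <= (1 - mu / m) E(x_k) <= (1 - lambda_min / m) E(x_k).
>>
    The second factor bounds the rate.  Convergence comes from the first:
    positive definiteness of S gives mu > 0, and nonnegativity of the energy
    after a step gives beta_i(x) <= E(x), whence mu <= m.  So 1 - mu / m lies in
    [0, 1) and the energies decay geometrically; the Euclidean norm is controlled
    by the energy through the same Rayleigh minimum, taken for the pair (P, 1)
    ([cvg_energy_contraction]). *)

(** * Quadratic forms and positive definite matrices *)

Definition quad {R : realType} {n : nat} (M : 'M[R]_n) (x : 'cV[R]_n) : R :=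
  (x^T *m M *m x) 0 0.

Lemma quadD {R : realType} {n} (M : 'M[R]_n) (x y : 'cV[R]_n) : M^T = M ->
  quad M (x + y) = quad M x + 2 * (y^T *m M *m x) 0 0 + quad M y.
Proof.
move=> sM; rewrite /quad [(x + y)^T]linearD /= mulmxDr !mulmxDl.
have -> : x^T *m M *m y = (y^T *m M *m x)^T.
  by rewrite !trmx_mul sM trmxK mulmxA.
have addE (A B : 'M[R]_1) : (A + B) 0 0 = A 0 0 + B 0 0 by rewrite mxE.
by rewrite !addE [_^T 0 0]mxE; ring.
Qed.

Lemma quadZ {R : realType} {n} (M : 'M[R]_n) a (x : 'cV[R]_n) :
  quad M (a *: x) = a ^+ 2 * quad M x.
Proof.
rewrite /quad [(a *: x)^T]linearZ /= -scalemxAr -!scalemxAl.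
have scaleE b (B : 'M[R]_1) : (b *: B) 0 0 = b * B 0 0 by rewrite mxE.
by rewrite !scaleE mulrA expr2.
Qed.

Lemma quad0 {R : realType} {n} (M : 'M[R]_n) : quad M 0 = 0.
Proof. by rewrite /quad mulmx0 mxE. Qed.

Lemma quad_congr {R : realType} {n k} (M : 'M[R]_n) (U : 'M[R]_(n, k))
    (x : 'cV[R]_k) : quad (U^T *m M *m U) x = quad M (U *m x).
Proof. by rewrite /quad trmx_mul !mulmxA. Qed.

Lemma quad_sum {R : realType} {n k} (M : 'I_k -> 'M[R]_n) (x : 'cV[R]_n) :
  quad (\sum_i M i) x = \sum_i quad (M i) x.
Proof. by rewrite /quad mulmx_sumr mulmx_suml summxE. Qed.

Lemma quadB {R : realType} {n} (M N : 'M[R]_n) (x : 'cV[R]_n) :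
  quad (M - N) x = quad M x - quad N x.
Proof. by rewrite /quad mulmxBr mulmxBl !mxE. Qed.

Lemma quad_mxZ {R : realType} {n} a (M : 'M[R]_n) (x : 'cV[R]_n) :
  quad (a *: M) x = a * quad M x.
Proof. by rewrite /quad -scalemxAr -scalemxAl mxE. Qed.

Lemma quad1E {R : realType} {n} (x : 'cV[R]_n) :
  quad 1%:M x = \sum_i x i 0 ^+ 2.
Proof.
by rewrite /quad mulmx1 mxE; apply: eq_bigr => i _; rewrite mxE expr2.
Qed.

Lemma spd_ge0 {R : realType} {n} (P : 'M[R]_n) (x : 'cV[R]_n) :
  spd P -> 0 <= quad P x.
Proof.
move=> [_ pP]; have [->|/pP/ltW //] := eqVneq x 0.
by rewrite quad0.
Qed.

Lemma spd_unitmx {R : realType} {n} (P : 'M[R]_n) : spd P -> P \in unitmx.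
Proof.
move=> [_ pP]; rewrite unitmxE unitfE; apply/det0P => -[v v0 vP].
have := pP v^T; rewrite trmxK vP mul0mx mxE ltxx => /(_ _)/negP; apply => //.
by rewrite -trmx0 (inj_eq trmx_inj).
Qed.

Lemma spd_congr {R : realType} {n k} (P : 'M[R]_n) (U : 'M[R]_(n, k)) :
  spd P -> (forall x : 'cV_k, U *m x = 0 -> x = 0) -> spd (U^T *m P *m U).
Proof.
move=> [sP pP] injU; split; first by rewrite !trmx_mul trmxK sP mulmxA.
move=> x x0; rewrite -[X in 0 < X]/(quad _ x) quad_congr; apply: pP.
by apply: contra x0 => /eqP/injU ->.
Qed.

Lemma spd_invmx {R : realType} {n} (P : 'M[R]_n) : spd P -> spd (invmx P).
Proof.
move=> sp; have uP := spd_unitmx sp; have [sP _] := sp.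
have -> : invmx P = (invmx P)^T *m P *m invmx P.
  by rewrite trmx_inv sP mulVmx // mul1mx.
apply: spd_congr => // x Px0.
by rewrite -[x]mul1mx -(mulmxV uP) -mulmxA Px0 mulmx0.
Qed.

Lemma spd1 {R : realType} {n} : spd (1%:M : 'M[R]_n).
Proof.
split; first exact: trmx1.
move=> x x0; rewrite -[X in 0 < X]/(quad _ x) quad1E lt_def.
rewrite sumr_ge0 ?andbT; last by move=> i _; exact: sqr_ge0.
apply: contra x0; rewrite psumr_eq0 => [/allP h|i _]; last exact: sqr_ge0.
apply/eqP/matrixP => i j; rewrite ord1 mxE; apply/eqP.
by have := h i (mem_index_enum i); rewrite sqrf_eq0.
Qed.

(** A zero of a nonnegative quadratic form is a minimum, so its gradient vanishes
    there; this is what makes a Rayleigh minimizer an eigenvector. *)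
Lemma psd_isotropic {R : realType} {n} (M : 'M[R]_n) (v : 'cV[R]_n) :
  M^T = M -> (forall x, 0 <= quad M x) -> quad M v = 0 -> M *m v = 0.
Proof.
move=> sM pM Mv0; apply/eqP/negP => /negP nz.
set w := M *m v in nz *.
have [_ /(_ _ nz)] := @spd1 R n.
rewrite -[X in 0 < X]/(quad _ w) => w0.
have wMv : (w^T *m M *m v) 0 0 = quad 1%:M w by rewrite /quad mulmx1 -mulmxA.
pose s := quad 1%:M w; pose b := quad M w.
(* quad M (v - t w) = - 2 t s + t^2 b, which is negative at this t since
   t b < s; the 1 in the denominator covers b = 0. *)
pose t := s / (b + 1).
have b0 : 0 <= b := pM w.
have := pM (v + (- t) *: w).
rewrite quadD // quadZ Mv0 add0r linearZ /= -!scalemxAl mxE wMv -/s -/b.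
have -> : s = t * (b + 1) by rewrite /t divfK // gt_eqF //; lra.
have t0 : 0 < t by rewrite divr_gt0 //; lra.
nra.
Qed.

(** * The minimum of a generalized Rayleigh quotient *)

(** In row form, to be used with the Heine-Borel theorem for row vectors. *)
Lemma quad_row_continuous {R : realType} {n} (M : 'M[R]_n) :
  continuous (fun v : 'rV[R]_n => quad M v^T).
Proof.
have -> : (fun v : 'rV[R]_n => quad M v^T)
    = (fun v => \sum_j (\sum_i v 0 i * M i j) * v 0 j).
  apply/funext => v; rewrite /quad trmxK mxE; apply: eq_bigr => j _.
  by rewrite !mxE.
have coord (j : 'I_n) : continuous (fun v : 'rV[R]_n => v 0 j).
  exact: coord_continuous.
have lin j : continuous (fun v : 'rV[R]_n => \sum_i v 0 i * M i j).
  apply: continuous_big => [|i _ v]; first exact: add_continuous.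
  exact: continuousM (coord i v) (@cst_continuous _ _ (M i j) v).
apply: continuous_big => [|j _ v]; first exact: add_continuous.
exact: continuousM (lin j v) (coord j v).
Qed.

(** The quotient quad A / quad P is invariant under scaling, so it attains its
    minimum mu on the unit sphere, which is compact.  Then A - mu P is nonnegative
    and vanishes at the minimizer, so [psd_isotropic] applies to it. *)
Lemma pencil_min {R : realType} {n} (A P : 'M[R]_n) :
  (0 < n)%N -> A^T = A -> spd P ->
  exists mu : R, exists v : 'cV[R]_n,
    [/\ v != 0, A *m v = mu *: (P *m v)
      & forall x, mu * quad P x <= quad A x].
Proof.
move=> n0 sA hP; have [sP pP] := hP.
have pos (x : 'cV[R]_n) : x != 0 -> 0 < quad P x by exact: pP.
have trnz (v : 'rV[R]_n) : v != 0 -> v^T != 0.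
  by move=> v0; rewrite -trmx0 (inj_eq trmx_inj).
pose K := [set v : 'rV[R]_n | `|v| = 1].
have Kn (v : 'rV[R]_n) : v != 0 -> K (`|v|^-1 *: v).
  by move=> v0; rewrite /K /= normrZ normfV normr_id mulVf // normr_eq0.
have Knz (v : 'rV[R]_n) : K v -> v != 0.
  by rewrite /K /= => v1; rewrite -normr_gt0 v1.
have K0 : K !=set0.
  exists (`|const_mx 1 : 'rV[R]_n|^-1 *: const_mx 1); apply: Kn.
  apply/eqP => /rowP /(_ (Ordinal n0)); rewrite !mxE => /eqP.
  by rewrite oner_eq0.
have cK : compact K.
  apply: bounded_closed_compact.
    exists 1; split; first exact: num_real.
    by move=> M M1 v; rewrite /K /= => ->; exact: ltW.
  have cn : continuous (fun v : 'rV[R]_n => `|v|) by exact: norm_continuous.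
  have c1 : closed [set y : R | y = 1] by exact: closed_eq.
  exact: (continuous_closedP _).1 cn _ c1.
pose f (v : 'rV[R]_n) := quad A v^T / quad P v^T.
have cf : {within K, continuous f}.
  apply: continuous_in_subspaceT => v /[!inE] Kv.
  have Pv0 : quad P v^T != 0 by rewrite gt_eqF // pos // trnz // Knz.
  have cP := @continuousV R _ (fun v : 'rV[R]_n => quad P v^T) v Pv0
    (@quad_row_continuous _ _ P v).
  exact: continuousM (@quad_row_continuous _ _ A v) cP.
have [u uK umin] := compact_EVT_min K0 cK cf.
move: uK; rewrite inE => uK.
have u0 : u^T != 0 by apply/trnz/Knz.
pose mu := f u.
have le_mu x : mu * quad P x <= quad A x.
  have [->|x0] := eqVneq x 0; first by rewrite !quad0 mulr0.
  have xt0 : x^T != 0 by rewrite -trmx0 (inj_eq trmx_inj).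
  have a0 : `|x^T|^-1 != 0 by rewrite invr_eq0 normr_eq0.
  have := umin (`|x^T|^-1 *: x^T); rewrite inE => /(_ (Kn _ xt0)).
  rewrite -/mu /f linearZ /= trmxK !quadZ -mulf_div divff ?expf_neq0 // mul1r.
  by rewrite ler_pdivlMr // pos.
exists mu, u^T; split=> //.
apply/eqP; rewrite -subr_eq0 scalemxAl -mulmxBl; apply/eqP.
apply: psd_isotropic.
- by rewrite linearB /= linearZ /= sA sP.
- by move=> x; rewrite quadB quad_mxZ subr_ge0.
- by rewrite quadB quad_mxZ /mu /f divfK ?subrr // gt_eqF // pos.
Qed.

Lemma spd_pencil_min {R : realType} {n} (A P : 'M[R]_n) :
  (0 < n)%N -> spd A -> spd P ->
  exists mu : R, exists v : 'cV[R]_n,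
    [/\ 0 < mu, v != 0, A *m v = mu *: (P *m v)
      & forall x, mu * quad P x <= quad A x].
Proof.
move=> n0 hA hP; have [mu [v [v0 Av mule]]] := pencil_min n0 hA.1 hP.
exists mu, v; split=> //; have Pv0 : 0 < quad P v by exact: hP.2.
have <- : quad A v / quad P v = mu.
  by rewrite {1}/quad -mulmxA Av -scalemxAr mxE mulmxA mulfK // gt_eqF.
by rewrite divr_gt0 //; exact: hA.2.
Qed.

(** * One block step *)

Lemma rows_ofE {R : realType} {n p} (A : {set 'I_n}) (M : 'M[R]_(n, p)) :
  rows_of A M = idrows R A *m M.
Proof. exact: rowsubE. Qed.

Lemma blkE {R : realType} {n} (P : 'M[R]_n) (A : {set 'I_n}) :
  blk P A = idrows R A *m P *m (idrows R A)^T.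
Proof. by rewrite /blk rows_ofE. Qed.

Lemma idrows_mul_tr {R : realType} {n} (A : {set 'I_n}) :
  idrows R A *m (idrows R A)^T = 1%:M.
Proof.
rewrite -rows_ofE; apply/matrixP => i j.
by rewrite !mxE (inj_eq enum_val_inj) eq_sym.
Qed.

Lemma blk_spd {R : realType} {n} (P : 'M[R]_n) (A : {set 'I_n}) :
  spd P -> spd (blk P A).
Proof.
move=> hP; rewrite blkE -{1}[idrows R A]trmxK; apply: spd_congr => // y y0.
by rewrite -[y]mul1mx -(@idrows_mul_tr R) -mulmxA y0 mulmx0.
Qed.

Lemma betaE {R : realType} {n} (P : 'M[R]_n) (q xopt x : 'cV[R]_n)
    (A : {set 'I_n}) : P *m xopt = q ->
  beta P q A x = quad (invmx (blk P A)) (idrows R A *m P *m (x - xopt)).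
Proof.
by move=> <-; rewrite /beta /pgrad !rows_ofE mulmxA -mulmxBr.
Qed.

(** The step subtracts from the error its P-orthogonal projection onto the
    coordinates in A, whose energy is beta; the equality is Pythagoras. *)
Lemma bcd_step_decrease {R : realType} {n} (P : 'M[R]_n)
    (q xopt x : 'cV[R]_n) (A : {set 'I_n}) : spd P -> P *m xopt = q ->
  quad P (bcd_step P q A x - xopt) = quad P (x - xopt) - beta P q A x.
Proof.
move=> hP Pq; rewrite (betaE _ _ Pq) /bcd_step addrAC -Pq !rows_ofE mulmxA.
set e := x - xopt; set U := idrows R A; set B := blk P A.
have -> : U *m P *m xopt - U *m P *m x = - (U *m P *m e).
  by rewrite -mulmxBr -mulmxN opprB.
set g := U *m P *m e.
have hB : spd B by exact: blk_spd.
have uB := spd_unitmx hB; have [sB' _] := spd_invmx hB; have [sP _] := hP.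
set B' := invmx B; pose y := U^T *m (B' *m g).
have -> : e + U^T *m B' *m - g = e + (-1) *: y.
  by rewrite scaleN1r mulmxN -mulmxA.
have yPe : (y^T *m P *m e) 0 0 = quad B' g.
  by rewrite /y /quad /g !trmx_mul trmxK sB' !mulmxA.
have yPy : quad P y = quad B' g.
  rewrite /y -quad_congr trmxK -blkE -/B -quad_congr sB'.
  by rewrite mulVmx // mul1mx.
rewrite quadD // quadZ yPy [((-1) *: y)^T]linearZ /= -!scalemxAl.
have -> : ((-1) *: (y^T *m P *m e)) 0 0 = - quad B' g.
  by rewrite mxE yPe mulN1r.
ring.
Qed.

(** * The block preconditioner and its spectral gap *)

Lemma mulmx_mxdiag_inv {R : realType} {m} {p : 'I_m -> nat}
    (B : forall i, 'M[R]_(p i)) : (forall i, B i \in unitmx) ->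
  \mxdiag_i B i *m \mxdiag_i invmx (B i) = 1%:M.
Proof.
move=> uB; rewrite [X in _ *m X]/mxdiag mul_mxdiag_mxblock.
rewrite -mxdiagZ; apply: eq_mxblock => i j.
by case: eqVneq => [->|]; rewrite ?conform_mx_id ?mulmx0 // mulmxV.
Qed.

Lemma invmx_mxdiag {R : realType} {m} {p : 'I_m -> nat}
    (B : forall i, 'M[R]_(p i)) : (forall i, B i \in unitmx) ->
  invmx (\mxdiag_i B i) = \mxdiag_i invmx (B i).
Proof.
move=> uB; have BB' := mulmx_mxdiag_inv uB.
have [u _] := mulmx1_unit BB'.
by rewrite -[LHS]mulmx1 -BB' mulmxA mulVmx // mul1mx.
Qed.

Lemma block_sumE {R : realType} {n m} (P : 'M[R]_n)
    (pi : 'I_m -> {set 'I_n}) : spd P ->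
  (idPi R pi)^T *m invmx (blockPi P pi) *m idPi R pi
  = \sum_i ((idrows R (pi i))^T *m invmx (blk P (pi i)) *m idrows R (pi i)).
Proof.
move=> hP; rewrite /blockPi invmx_mxdiag; last first.
  by move=> i; apply/spd_unitmx/blk_spd.
by rewrite /idPi tr_mxcol mul_mxrow_mxdiag mul_mxrow_mxcol.
Qed.

(** Each block contributes a nonnegative form that vanishes only when all the
    coordinates in this block do, so covering the indices gives definiteness. *)
Lemma block_sum_spd {R : realType} {n m} (P : 'M[R]_n)
    (pi : 'I_m -> {set 'I_n}) : spd P -> (forall j, exists i, j \in pi i) ->
  spd ((idPi R pi)^T *m invmx (blockPi P pi) *m idPi R pi).
Proof.
move=> hP cov; rewrite block_sumE //.
have hB i : spd (invmx (blk P (pi i))) by apply/spd_invmx/blk_spd.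
split.
  rewrite [LHS]linear_sum /=; apply: eq_bigr => i _.
  by rewrite !trmx_mul trmxK (hB i).1 mulmxA.
move=> x x0; rewrite -[X in 0 < X]/(quad _ x) quad_sum.
have ge0 i : 0 <= quad ((idrows R (pi i))^T *m invmx (blk P (pi i))
                        *m idrows R (pi i)) x.
  by rewrite quad_congr; apply: spd_ge0.
rewrite lt_def sumr_ge0 // andbT; apply: contra x0.
rewrite psumr_eq0 // => /allP h; apply/eqP/matrixP => j k; rewrite ord1 mxE.
have [i ji] := cov j.
have := h i (mem_index_enum i); rewrite /= quad_congr => /eqP z.
have : idrows R (pi i) *m x = 0.
  apply/eqP/negPn/negP => nz; have := (hB i).2 _ nz.
  by rewrite -[X in 0 < X]/(quad _ _) z ltxx.
rewrite -rows_ofE => /matrixP /(_ (enum_rank_in ji j) 0).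
by rewrite !mxE enum_rankK_in.
Qed.

(** The constant mu is the Rayleigh minimum of P S P against P.  It need only be
    some eigenvalue of P_Pi B_Pi^-1, since the smallest one is below it. *)
Lemma block_gap {R : realType} {n m} (P : 'M[R]_n)
    (pi : 'I_m -> {set 'I_n}) : (0 < n)%N -> spd P ->
  (forall j, exists i, j \in pi i) ->
  exists mu : R, [/\ 0 < mu,
    eigenvalue (permPi P pi *m invmx (blockPi P pi)) mu
    & forall e, mu * quad P e <= \sum_i
        quad (invmx (blk P (pi i))) (idrows R (pi i) *m P *m e)].
Proof.
move=> n0 hP cov; have [sP _] := hP; have uP := spd_unitmx hP.
set U := idPi R pi; set B := blockPi P pi.
pose S := U^T *m invmx B *m U.
have hS : spd S by exact: block_sum_spd.
have hA : spd (P^T *m S *m P).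
  apply: spd_congr => // x Px0.
  by rewrite -[x]mul1mx -(mulVmx uP) -mulmxA Px0 mulmx0.
have [mu [v [mu0 v0 Av mle]]] := spd_pencil_min n0 hA hP.
exists mu; split=> //.
  (* As v^T P S = mu v^T, stopping this product just before its last factor
     I_Pi gives a left eigenvector of P_Pi B_Pi^-1; it is nonzero because its
     product with I_Pi is mu v^T. *)
  pose w := v^T *m P *m U^T *m invmx B.
  have wU : w *m U = mu *: v^T.
    have : v^T *m P *m S *m P = mu *: (v^T *m P).
      have := congr1 trmx Av; rewrite linearZ /= trmx_mul hA.1 trmx_mul sP.
      by rewrite !mulmxA.
    move=> /(congr1 (mulmx^~ (invmx P))); rewrite -scalemxAl !mulmxK //.
    by rewrite /S !mulmxA.
  apply/eigenvalueP; exists w.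
    by rewrite /permPi -/U !mulmxA wU -!scalemxAl.
  apply: contraNneq v0 => w0; move: wU; rewrite w0 mul0mx => /esym/eqP.
  by rewrite scaler_eq0 gt_eqF //= => /eqP vt0; rewrite -[v]trmxK vt0 trmx0.
move=> e; apply: le_trans (mle e) _.
rewrite quad_congr /S block_sumE // quad_sum.
by apply: ler_sum => i _; rewrite quad_congr mulmxA.
Qed.

(** * Convergence and rate *)

Lemma normP_sqr {R : realType} {n} (P : 'M[R]_n) (x : 'cV[R]_n) :
  spd P -> normP P x ^+ 2 = quad P x.
Proof. by move=> hP; rewrite /normP sqr_sqrtr //; exact: spd_ge0. Qed.

Lemma admissible_cover {R : realType} (rho : nat -> nat) {n m}
    (pi : 'I_m -> {set 'I_n}) : admissible R rho pi ->
  forall j, exists i, j \in pi i.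
Proof.
move=> [_ /and3P[/eqP cov _ _] _] j.
have := finset.in_setT j; rewrite -cov => /bigcupP[A /imsetP[i _ ->] ji].
by exists i.
Qed.

(** In dimension 0 the block sizes would have to lie strictly below sqrt 0. *)
Lemma admissible_gt0 {R : realType} (rho : nat -> nat) {n m}
    (pi : 'I_m -> {set 'I_n}) : admissible R rho pi -> (0 < n)%N.
Proof.
move=> [_ _]; case: n pi => // pi; rewrite lt_min sqrtr0.
by rewrite ltNge ler0n.
Qed.

(** Energies decay like c^k, and mu times the square of any coordinate of the
    error is at most the energy, mu > 0 being the Rayleigh minimum of P against
    the identity. *)
Lemma cvg_energy_contraction {R : realType} {n} (P : 'M[R]_n) (c : R)
    (y : 'cV[R]_n) (x : nat -> 'cV[R]_n) : (0 < n)%N -> spd P -> 0 <= c < 1 ->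
  (forall k, quad P (x k.+1 - y) <= c * quad P (x k - y)) ->
  x k @[k --> \oo] --> y.
Proof.
move=> n0 hP /andP[c0 c1] xk.
have [mu [_ [mu0 _ _ mule]]] := spd_pencil_min n0 hP (@spd1 R n).
have geo k : quad P (x k - y) <= c ^+ k * quad P (x 0%N - y).
  elim: k => [|k IH]; first by rewrite mul1r.
  by apply: le_trans (xk k) _; rewrite exprS -mulrA ler_wpM2l.
have cvg0 : c ^+ k * quad P (x 0%N - y) @[k --> \oo] --> (0 : R).
  rewrite -[X in _ --> X](mul0r (quad P (x 0%N - y))).
  by apply: cvgMl; apply: cvg_expr; rewrite ger0_norm.
apply/cvg_ballP => eps eps0.
have e0 : 0 < mu * eps ^+ 2 by rewrite mulr_gt0 // exprn_gt0.
near=> k.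
have small : c ^+ k * quad P (x 0%N - y) < mu * eps ^+ 2.
  by near: k; exact: cvgr_lt cvg0 _ e0.
split=> // i j; rewrite ord1.
have : mu * (x k i 0 - y i 0) ^+ 2 < mu * eps ^+ 2.
  apply: le_lt_trans small; apply: le_trans (geo k); apply: le_trans (mule _).
  rewrite ler_pM2l // quad1E (bigD1 i) //= !mxE lerDl sumr_ge0 // => l _.
  exact: sqr_ge0.
rewrite ltr_pM2l // -[X in X < _]real_normK ?num_real // ltr_pXn2r //.
- by rewrite /ball /= distrC.
- by rewrite nnegrE ltW.
Unshelve. all: by end_near. Qed.

Unset Implicit Arguments.

Theorem theorem1 (R : realType) (n m : nat) (rho : nat -> nat)
    (P : 'M[R]_n) (q : 'cV[R]_n) (r : R)
    (pi : 'I_m -> {set 'I_n})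
    (xopt x0 : 'cV[R]_n) (x : nat -> 'cV[R]_n)
    (hrho : forall k : nat, (0 < rho k)%N)
    (hP : spd P)
    (hopt : is_minimizer (quadf P q r) xopt)
    (hpi : admissible R rho pi)
    (hx : gbcd P q pi x0 x) :
  x k @[k --> \oo] --> xopt /\
  (rate P xopt x <=
     (1 - m%:R^-1 * lambda_min (permPi P pi *m invmx (blockPi P pi)))%:E)%E.
Proof.
have Pq : P *m xopt = q.
  rewrite ((quadf_minimizerP _ _ _ hP).1 hopt).
  by rewrite mulmxA mulmxV ?mul1mx //; exact: spd_unitmx.
have n0 := admissible_gt0 hpi; have cov := admissible_cover hpi.
have m0 : (0 < m)%N.
  by have [i _] := cov (Ordinal n0); exact: leq_ltn_trans (ltn_ord i).
have mR0 : 0 < m%:R :> R by rewrite ltr0n.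
have [mu [mu0 eig gap]] := block_gap n0 hP cov.
set L := lambda_min _.
have Lmu : L <= mu by exact: (lambda_minP eig).2.
have gap_beta z : mu * quad P (z - xopt) <= \sum_i beta P q (pi i) z.
  apply: le_trans (gap _) _; apply: ler_sum => i _.
  by rewrite (betaE _ _ Pq).
(* The residual energy after a block step is nonnegative, so no block can
   account for more than the whole energy. *)
have beta_le z i : beta P q (pi i) z <= quad P (z - xopt).
  rewrite -subr_ge0 -(bcd_step_decrease _ _ hP Pq); exact: spd_ge0.
(* Compare both bounds at any point where the energy is positive. *)
have mum : mu <= m%:R.
  pose z := xopt + const_mx 1.
  have e0 : 0 < quad P (z - xopt).
    apply: hP.2; rewrite /z addrC addKr; apply/eqP.
    move=> /matrixP /(_ (Ordinal n0) 0); rewrite !mxE => /eqP.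
    by rewrite oner_eq0.
  rewrite -(ler_pM2r e0); apply: le_trans (gap_beta z) _.
  apply: le_trans (ler_sum _ (fun i _ => beta_le z i)) _.
  by rewrite sumr_const card_ord mulr_natl.
have step k : quad P (x k.+1 - xopt) <= (1 - mu / m%:R) * quad P (x k - xopt).
  have [i [imax ->]] := hx.2 k.
  rewrite bcd_step_decrease // mulrBl mul1r lerD2l lerN2.
  rewrite mulrAC ler_pdivrMr //; apply: le_trans (gap_beta _) _.
  apply: le_trans (ler_sum _ (fun j _ => imax j)) _.
  by rewrite sumr_const card_ord mulr_natr.
split.
  apply: cvg_energy_contraction n0 hP _ step.
  by rewrite subr_ge0 ler_pdivrMr // mul1r mum ltrBlDr ltrDl divr_gt0.
have mon : 1 - mu / m%:R <= 1 - m%:R^-1 * L.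
  by rewrite lerD2l lerN2 mulrC ler_pM2r // invr_gt0.
rewrite /rate; case: ifPn => _; last first.
  rewrite lee_fin; apply: le_trans mon.
  by rewrite subr_ge0 ler_pdivrMr // mul1r.
apply: ge_ereal_sup => _ [k xk <-]; rewrite lee_fin; apply: le_trans mon.
have pk : 0 < quad P (x k - xopt) by apply: hP.2; rewrite subr_eq0.
by rewrite /rate_at !normP_sqr // ler_pdivrMr.
Qed.
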